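(* For every triple $(M,\pi_0,\mathcal L)$ comprising (1) a deterministic MDP $M=(S,A,T,R,\gamma)$ with $|S|=2$ and $|A|=k\ge 2$, (2) a policy $\pi_0:S\to A$ for $M$, and (3) a policy iteration (PI) algorithm $\mathcal L$, the number of policies evaluated by $\mathcal L$ if initialised at $\pi_0$ and executed on $M$ is at most $\frac{k^2}{2}+2k-1$.
   Context: A (finite, discounted) MDP is a tuple $(S,A,T,R,\gamma)$ with finite state set $S$; finite action set $A$ (all actions available at every state); transition function $T:S\times A\times S\to[0,1]$ with $\sum_{s'}T(s,a,s')=1$; reward function $R:S\times A\to\mathbb R$; and discount factor $\gamma\in[0,1)$. It is deterministic (a DMDP) if $T$ takes values in $\{0,1\}$. A policy is a map $\pi:S\to A$. Its value function $V^\pi:S\to\mathbb R$ is the unique solution of $V^\pi(s)=R(s,\pi(s))+\gamma\sum_{s'}T(s,\pi(s),s')V^\pi(s')$. The action value function is $Q^\pi(s,a)=R(s,a)+\gamma\sum_{s'}T(s,a,s')V^\pi(s')$ and the gain is $\rho^\pi(s,a)=Q^\pi(s,a)-V^\pi(s)$. The improvable set is $I^\pi=\{(s,a):\rho^\pi(s,a)>0\}$. A valid improvement set is a nonempty $I\subseteq I^\pi$ containing at most one pair $(s,a)$ for each $s\in S$. A policy improvement step from $\pi$ using $I$ yields the policy $\pi'$ with $\pi'(s)=a$ if $(s,a)\in I$ and $\pi'(s)=\pi(s)$ otherwise. A PI algorithm, started at a policy $\pi_0$, produces a sequence $\pi_0,\pi_1,\dots,\pi_\ell$, each $\pi_{i+1}$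 being obtained from $\pi_i$ by a policy improvement step with a valid improvement set $I\subseteq I^{\pi_i}$ of the algorithm's (arbitrary) choosing, and stops when $I^{\pi_\ell}=\emptyset$. The policies evaluated are $\pi_0,\dots,\pi_\ell$, so their number is $\ell+1$. *)

(* Defs.v *)
From HB Require Import structures.
From mathcomp Require Import all_boot all_order all_algebra.
From mathcomp Require Import boolp reals.

Set Implicit Arguments.
Unset Strict Implicit.
Unset Printing Implicit Defensive.

Import Order.TTheory GRing.Theory Num.Theory.
Local Open Scope ring_scope.

Record mdp (R : realType) (S A : finType) := Mdp {
  trans : S -> A -> S -> R;
  reward : S -> A -> R;
  discount : R;
  trans_itv : forall s a s', 0 <= trans s a s' <= 1;
  trans_sum1 : forall s a, \sum_s' trans s a s' = 1;
  discount_itv : 0 <= discount < 1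
}.

Definition deterministic (R : realType) (S A : finType) (M : mdp R S A) : Prop :=
  forall s a s', trans M s a s' = 0 \/ trans M s a s' = 1.

Notation policy S A := {ffun S -> A}.

Section PolicyIteration.
Variables (R : realType) (S A : finType).
Implicit Types (M : mdp R S A) (pi : policy S A) (V : {ffun S -> R}).
Implicit Types (I : {set S * A}) (past tr : seq (policy S A)).

Definition policy_equations M pi V : Prop :=
  forall s, V s = reward M s (pi s)
                  + discount M * \sum_s' trans M s (pi s) s' * V s'.

Lemma policy_equations0 M pi (W : S -> R) :
  (forall s, W s = discount M * \sum_s' trans M s (pi s) s' * W s') ->
  forall s, W s = 0.
Proof.
move=> hW s0; apply/eqP; rewrite -normr_le0.
case: (@arg_maxP _ R S s0 xpredT (fun s => `|W s|)) => // s _ smax.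
apply: (le_trans (smax s0 isT)).
have /andP[g0 g1] := discount_itv M.
have : `|W s| <= discount M * `|W s|.
  rewrite {1}hW normrM ger0_norm //; apply: ler_wpM2l => //.
  apply: (le_trans (ler_norm_sum _ _ _)).
  rewrite -[leRHS]mul1r -(trans_sum1 M s (pi s)) mulr_suml.
  apply: ler_sum => s' _; have /andP[t0 _] := trans_itv M s (pi s) s'.
  by rewrite normrM ger0_norm // ler_wpM2l //; exact: smax.
by rewrite -subr_ge0 -{2}[`|W s|]mul1r -mulrBl nmulr_rge0 // subr_lt0.
Qed.

Lemma policy_equations_unique M pi V W :
  policy_equations M pi V -> policy_equations M pi W -> V = W.
Proof.
move=> hV hW; apply/ffunP => s; apply/eqP; rewrite -subr_eq0; apply/eqP.
move: s; apply: (@policy_equations0 M pi (fun s => V s - W s)) => s.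
rewrite {1}hV {1}hW opprD addrACA subrr add0r -mulrBr -sumrB.
by congr (_ * _); apply: eq_bigr => s' _; rewrite mulrBr.
Qed.

Lemma policy_equations_solvable M pi : exists V, policy_equations M pi V.
Proof.
pose f (V : {ffun S -> R^o}) : {ffun S -> R^o} :=
  [ffun s => V s - discount M * \sum_s' trans M s (pi s) s' * V s'].
have f_lin : linear f.
  move=> c V W; apply/ffunP => s; rewrite !ffunE /=.
  rewrite /GRing.scale /= mulrBr addrACA -opprD; congr (_ - _).
  rewrite mulrCA -mulrDr; congr (_ * _).
  rewrite mulr_sumr -big_split /=; apply: eq_bigr => s' _.
  by rewrite !ffunE /GRing.scale /= mulrDr mulrCA.
pose fL := GRing.isLinear.Build R _ _ _ f f_lin.
pose F : {linear {ffun S -> R^o} -> {ffun S -> R^o}} := HB.pack f fL.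
have F0 : lker (linfun F) == 0%VS.
  apply/lker0P => V W; rewrite !lfunE /= => /ffunP e; apply/ffunP => s.
  apply/eqP; rewrite -subr_eq0; apply/eqP; move: s.
  apply: (@policy_equations0 M pi (fun s => V s - W s)) => s.
  have := e s; rewrite !ffunE => /(canRL (subrK _)) ->.
  rewrite addrAC [W s - _]addrC addrK addrC -mulrBr -sumrB.
  by congr (_ * _); apply: eq_bigr => s' _; rewrite mulrBr.
have [V hV] : exists V, F V = [ffun s => reward M s (pi s)].
  have := memvf ([ffun s => reward M s (pi s)] : {ffun S -> R^o}).
  by rewrite -(lker0_limgf F0) => /memv_imgP[V _ ->]; exists V; rewrite lfunE.
exists V => s; move/ffunP/(_ s): hV; rewrite !ffunE => <-.
by rewrite subrK.
Qed.

Definition value M pi : {ffun S -> R} := sval (cid (policy_equations_solvable M pi)).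

Lemma valueP M pi : policy_equations M pi (value M pi).
Proof. exact: svalP (cid _). Qed.

Definition action_value M pi (s : S) (a : A) : R :=
  reward M s a + discount M * \sum_s' trans M s a s' * value M pi s'.

Definition gain M pi (s : S) (a : A) : R := action_value M pi s a - value M pi s.

Definition improvable M pi : {set S * A} := [set sa | 0 < gain M pi sa.1 sa.2].

Definition valid_improvement_set M pi I : Prop :=
  [/\ I != set0, I \subset improvable M pi &
      forall s a b, (s, a) \in I -> (s, b) \in I -> a = b].

(* For a valid improvement set I there is at most one candidate for [pick]. *)
Definition improvement_step pi I : policy S A :=
  [ffun s => odflt (pi s) [pick a | (s, a) \in I]].

(* [choose_set M past pi] is the set used to improve the current policy pi,
   where past lists the policies evaluated before pi, oldest first.  The choice
   may depend on the whole past, so that every sequence of arbitrary valid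
   choices is the execution of some algorithm. *)
Record pi_algorithm := PIAlgorithm {
  choose_set : mdp R S A -> seq (policy S A) -> policy S A -> {set S * A};
  choose_setP : forall M past pi, improvable M pi != set0 ->
    valid_improvement_set M pi (choose_set M past pi)
}.

(* [execution L M past pi tr]: having already evaluated the policies in past,
   L evaluates on M exactly the policies in tr, starting with pi, then stops. *)
Inductive execution (L : pi_algorithm) M past pi : seq (policy S A) -> Prop :=
| ExecStop of improvable M pi = set0 : execution L M past pi [:: pi]
| ExecStep tr of improvable M pi != set0 &
    execution L M (rcons past pi)
      (improvement_step pi (choose_set L M past pi)) tr :
    execution L M past pi (pi :: tr).

Lemma execution_unique L M past pi tr tr' :
  execution L M past pi tr -> execution L M past pi tr' -> tr = tr'.
Proof.
move=> ex; elim: ex tr' => {past pi tr} [past pi i0|past pi tr i0 _ IH] tr' ex'.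
  by case: ex' => // ? /eqP.
by case: ex' => [/eqP i0'|tr1 _ /IH ->//]; rewrite i0' in i0.
Qed.

End PolicyIteration.

(* Main.v *)
Require Import Defs.
From mathcomp Require Import all_boot all_order all_algebra.
From mathcomp Require Import boolp reals.
From mathcomp Require Import zify ring lra.
Import Order.TTheory GRing.Theory Num.Theory.
Local Open Scope ring_scope.

Set Implicit Arguments.
Unset Strict Implicit.

(** Split the actions at a state s into p self-loops and k - p crossings to the
    other state.  A self-loop alone determines the value of s, and the value of
    s strictly increases whenever its action is switched, so a self-loop once
    abandoned is never used again; a direct switch between crossings strictly
    increases the reward.  Hence the action at s is switched at most
    p (k - p) + k - 1 <= k^2 / 4 + k - 1 times, and each improvement step
    switches the action of at least one of the two states. *)

Section Improvement.
Variables (R : realType) (S A : finType) (M : mdp R S A).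
Implicit Types (pi : policy S A) (I : {set S * A}) (s : S) (a : A).

Lemma gain_policy pi s : gain M pi s (pi s) = 0.
Proof. by rewrite /gain /action_value -(valueP M pi) subrr. Qed.

Lemma improvement_stepP pi I s :
  (s, improvement_step pi I s) \in I \/
  improvement_step pi I s = pi s /\ (forall a, (s, a) \notin I).
Proof.
rewrite /improvement_step ffunE; case: pickP => [a aI|noI]; first by left.
by right; split=> // a; rewrite noI.
Qed.

Lemma value_step_gain pi pi' :
  (forall s, 0 <= gain M pi s (pi' s)) ->
  forall s, value M pi s + gain M pi s (pi' s) <= value M pi' s.
Proof.
move=> g0; pose W s := value M pi' s - value M pi s.
have /andP[d0 d1] := discount_itv M.
have WE s : W s = gain M pi s (pi' s)
    + discount M * \sum_s' trans M s (pi' s) s' * W s'.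
  have -> : \sum_s' trans M s (pi' s) s' * W s' =
      \sum_s' trans M s (pi' s) s' * value M pi' s' -
      \sum_s' trans M s (pi' s) s' * value M pi s'.
    by rewrite -sumrB; apply: eq_bigr => s' _; rewrite mulrBr.
  rewrite /W (valueP M pi' s) /gain /action_value; ring.
have W0 s0 : 0 <= W s0.
  case: (@arg_minP _ R S s0 xpredT W) => // s _ smin.
  apply: le_trans (smin s0 isT).
  suff : discount M * W s <= W s by rewrite -subr_ge0; nra.
  rewrite {2}WE -[leLHS]add0r lerD //; apply: ler_wpM2l => //.
  rewrite -[leLHS]mul1r -(trans_sum1 M s (pi' s)) mulr_suml.
  apply: ler_sum => s' _; have /andP[t0 _] := trans_itv M s (pi' s) s'.
  by rewrite ler_wpM2l // smin.
move=> s; rewrite addrC -lerBrDr -/(W s) WE lerDl mulr_ge0 // sumr_ge0 // => s' _.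
by have /andP[t0 _] := trans_itv M s (pi' s) s'; rewrite mulr_ge0.
Qed.

Lemma gain_switch pi I s a :
  valid_improvement_set M pi I -> (s, a) \in I -> 0 < gain M pi s a.
Proof. by case=> _ /subsetP sub _ /sub; rewrite inE. Qed.

Lemma value_improvement_step pi I s : valid_improvement_set M pi I ->
  value M pi s + gain M pi s (improvement_step pi I s)
    <= value M (improvement_step pi I) s.
Proof.
move=> vI; apply: value_step_gain => t.
case: (improvement_stepP pi I t) => [/(gain_switch vI)/ltW //|[-> _]].
by rewrite gain_policy.
Qed.

End Improvement.

Section TwoStates.
Variables (R : realType) (S A : finType) (M : mdp R S A).
Hypotheses (hS : #|S| = 2%N) (hM : deterministic M).
Implicit Types (pi : policy S A) (I : {set S * A}) (s : S) (a : A).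

Definition loops s := [set a | trans M s a s == 1].

Definition loop_value s a := reward M s a / (1 - discount M).

Lemma trans_loop s a s' : a \in loops s -> trans M s a s' = (s' == s)%:R.
Proof.
rewrite inE => /eqP ta; have [->//|s's] := eqVneq s' s.
have := trans_sum1 M s a; rewrite (bigD1 s) //= ta.
move=> /(canRL (addKr 1)); rewrite addNr => /psumr_eq0P -> // t _.
by have /andP[] := trans_itv M s a t.
Qed.

Lemma trans_cross s a s' : a \notin loops s -> trans M s a s' = (s' != s)%:R.
Proof.
rewrite inE => ta1.
have ta : trans M s a s = 0 by case: (hM s a s) ta1 => ->; rewrite ?eqxx.
have [->//|s's /=] := eqVneq s' s.
have := trans_sum1 M s a; rewrite (bigD1 s) //= ta add0r (bigD1 s') //=.
rewrite big1 ?addr0 // => t /andP[ts ts'].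
(* A third state [t] would contradict [hS], so all the mass goes to [s']. *)
have : (#|t |: [set s; s']| <= #|S|)%N by rewrite max_card.
by rewrite hS cardsU1 cards2 !inE negb_or ts ts' eq_sym s's.
Qed.

Lemma value_loop pi s : pi s \in loops s -> value M pi s = loop_value s (pi s).
Proof.
move=> ls; have /andP[_ d1] := discount_itv M.
have := valueP M pi s; rewrite (bigD1 s) //= trans_loop // eqxx mul1r.
rewrite big1 ?addr0 => [eV|t /negPf ts]; last by rewrite trans_loop // ts mul0r.
apply: (canRL (mulfK _)); first by rewrite subr_eq0 gt_eqF.
by rewrite mulrBr mulr1 mulrC {1}eV addrK.
Qed.

(** All crossings at [s] lead to the same state, so the discounted terms cancel. *)
Lemma gain_cross pi s a : pi s \notin loops s -> a \notin loops s ->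
  gain M pi s a = reward M s a - reward M s (pi s).
Proof.
move=> cs ca; rewrite /gain /action_value (valueP M pi s).
rewrite [X in _ - (_ + _ * X)](_ : _ = \sum_s' trans M s a s' * value M pi s').
  ring.
by apply: eq_bigr => s' _; rewrite !trans_cross.
Qed.

Definition better_loops pi s := [set a in loops s | value M pi s < loop_value s a].

Definition better_crosses pi s :=
  [set a in ~: loops s | reward M s (pi s) < reward M s a].

(* Bounds the number of switches still possible at s: before each of the
   remaining better loops, every crossing can be used once. *)
Definition potential pi s : nat :=
  #|better_loops pi s| * #|~: loops s|.+1 +
  (if pi s \in loops s then #|~: loops s| else #|better_crosses pi s|).

Lemma card_better_crosses pi s :
  pi s \notin loops s -> (#|better_crosses pi s| < #|~: loops s|)%N.
Proof.
move=> cs; apply/proper_card/properP.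
split; first by apply/subsetP => a; rewrite inE => /andP[].
by exists (pi s); rewrite inE ?ltxx ?andbF.
Qed.

(** Strictness comes from the current action: a loop in use is not better than itself, nor is a
    crossing in use. *)
Lemma potential_lt pi s :
  (potential pi s < #|loops s| * #|~: loops s|.+1 + #|~: loops s|)%N.
Proof.
have sL : better_loops pi s \subset loops s.
  by apply/subsetP => a; rewrite inE => /andP[].
rewrite /potential; case: ifPn => ls.
  rewrite ltn_add2r ltn_pmul2r //; apply/proper_card/properP; split=> //.
  by exists (pi s) => //; rewrite inE value_loop // ltxx andbF.
rewrite -addnS leq_add ?card_better_crosses // leq_mul2r.
by rewrite subset_leq_card ?orbT.
Qed.

(** With [p] loops and [c] crossings, [p (c + 1) + c = p c + k], and [4 p c <= k ^ 2] by AM-GM. *)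
Lemma potential_le pi s : (4 * potential pi s + 4 <= #|A| ^ 2 + 4 * #|A|)%N.
Proof.
rewrite -(cardsC (loops s)).
have := potential_lt pi s; have [+ _] := nat_AGM2 #|loops s| #|~: loops s|.
by rewrite mulnS; lia.
Qed.

Section Step.
Variables (pi : policy S A) (I : {set S * A}).
Hypothesis vI : valid_improvement_set M pi I.
Let pi' := improvement_step pi I.

Lemma better_loops_step s : better_loops pi' s \subset better_loops pi s.
Proof.
apply/subsetP => a; rewrite !inE => /andP[-> /=]; apply: le_lt_trans.
apply: le_trans (value_improvement_step s vI); rewrite lerDl.
have [sI|[e _]] := improvement_stepP pi I s; last by rewrite e gain_policy.
exact/ltW/(gain_switch vI).
Qed.

(** Switching to a loop uses up a better loop, worth one more than the second summand can regain.
    Any other switch lowers the second summand. *)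
Lemma potential_switch s : (s, pi' s) \in I -> (potential pi' s < potential pi s)%N.
Proof.
move=> sI.
have g0 : 0 < gain M pi s (pi' s) := gain_switch vI sI.
have lV : value M pi s < value M pi' s.
  by apply: lt_le_trans (value_improvement_step s vI); rewrite ltrDl.
have cL := subset_leq_card (better_loops_step s).
rewrite /potential; case: ifPn => [ls'|cs'].
  have : (#|better_loops pi' s| < #|better_loops pi s|)%N.
    apply/proper_card/properP; split; first exact: better_loops_step.
    (* The new loop value is the new value of [s]: above the old value, but not above itself. *)
    exists (pi' s); last by rewrite inE value_loop // ltxx andbF.
    by rewrite inE ls' -value_loop.
  by case: ifP => _; nia.
case: ifPn => [ls|cs]; first by have := card_better_crosses cs'; nia.
have : (#|better_crosses pi' s| < #|better_crosses pi s|)%N.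
  move: g0; rewrite gain_cross // subr_gt0 => lR.
  apply/proper_card/properP; split.
    by apply/subsetP => a; rewrite !inE => /andP[-> /=]; apply: lt_trans.
  exists (pi' s); first by rewrite inE lR inE cs'.
  by rewrite inE ltxx andbF.
by nia.
Qed.

(** At an unswitched state only the value can change, and a rise can only remove better loops. *)
Lemma potential_step s : (potential pi' s <= potential pi s)%N.
Proof.
have [sI|[e _]] := improvement_stepP pi I s; last first.
  rewrite /potential /better_crosses e leq_add2r leq_mul2r.
  by rewrite subset_leq_card ?orbT // better_loops_step.
exact: ltnW (potential_switch sI).
Qed.

End Step.

(** Induction on the total potential, for every [past], also yields termination: a valid set is
    nonempty, so some state is switched. *)
Lemma execution_potential (L : pi_algorithm R S A) past pi :
  exists tr, execution L M past pi tr /\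
    (size tr <= (\sum_s potential pi s).+1)%N.
Proof.
have [n] := ubnP (\sum_s potential pi s); elim: n => // n IH in past pi *.
move=> lt_n; have [i0|i0] := eqVneq (improvable M pi) set0.
  by exists [:: pi]; split; first exact: ExecStop.
have vI := choose_setP L past i0; pose I := choose_set L M past pi.
have lt_pot : (\sum_s potential (improvement_step pi I) s < \sum_s potential pi s)%N.
  have [/set0Pn[[s a] sa] _ _] := vI.
  have sI : (s, improvement_step pi I s) \in I.
    by have [//|[_ /(_ a)]] := improvement_stepP pi I s; rewrite sa.
  rewrite (bigD1 s) //= [ltnRHS](bigD1 s) //= -addSn leq_add //.
    exact: potential_switch.
  by apply: leq_sum => t _; exact: potential_step.
have [|tr [ex le_tr]] := IH (rcons past pi) (improvement_step pi I).
  exact: leq_trans lt_pot _.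
exists (pi :: tr); split; first exact: ExecStep.
exact: leq_ltn_trans le_tr _.
Qed.

End TwoStates.

Theorem proposition3 (R : realType) (S A : finType) (k : nat)
    (M : mdp R S A) (pi0 : policy S A) (L : pi_algorithm R S A)
    (hS : #|S| = 2%N) (hA : #|A| = k) (hk : (2 <= k)%N)
    (hM : deterministic M) :
  exists tr : seq (policy S A),
    execution L M [::] pi0 tr /\
    (size tr)%:R <= k%:R ^+ 2 / 2 + 2 * k%:R - 1 :> R.
Proof.
have [tr [ex le_tr]] := @execution_potential R S A M hS hM L [::] pi0.
exists tr; split=> //.
(* The two states contribute 8 to the left of the summed bounds; 4 of it pays for the final policy,
   and the other 4 becomes the [- 1]. *)
have : (4 * size tr + 4 <= 2 * (k ^ 2 + 4 * k))%N.
  have : (\sum_s (4 * potential M pi0 s + 4) <= \sum_(s : S) (k ^ 2 + 4 * k))%N.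
    by apply: leq_sum => s _; rewrite -hA; exact: potential_le.
  by rewrite big_split /= -big_distrr /= !sum_nat_const hS; lia.
by rewrite -(ler_nat R) !(natrD, natrM, natrX); lra.
Qed.
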